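(* Let $k$ be a field of characteristic $0$ and let $q\in k^\times$ be not a root of unity. Let $k[x]\#k[y,y^{-1}]$ be the quantum cylinder, i.e. the vector space $k[x]\otimes k[y,y^{-1}]$ with the multiplication determined by $y^jx^i=q^{ij}x^iy^j$ for all $i\ge 0$ and $j\in\mathbb{Z}$. Then its Hochschild homology is $$HH_n(k[x]\#k[y,y^{-1}])\cong\begin{cases} k[y,y^{-1}] & \text{if } n=0,1,\\ 0 & \text{if } n\ge 2,\end{cases}$$ as $k$-vector spaces.
   Context: $HH_n(C)=H_n(C,C)=\mathrm{Tor}_n^{C\otimes C^{\mathrm{op}}}(C,C)$ denotes the Hochschild homology over $k$ of a unital associative $k$-algebra $C$ with coefficients in itself. *)

(* Defs.v *)
From HB Require Import structures.
From mathcomp Require Import all_boot all_algebra.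
From mathcomp Require Import boolp.
From mathcomp Require Import finmap monalg.

Set Implicit Arguments.
Unset Strict Implicit.
Unset Printing Implicit Defensive.

Import GRing.Theory.
Local Open Scope ring_scope.
Local Open Scope quotient_scope.

Section Span.
Variables (k : pzRingType) (V : lmodType k).

Definition submodule (U : V -> Prop) : Prop :=
  U 0 /\ forall a u v, U u -> U v -> U (a *: u + v).

Definition span (S : V -> Prop) (v : V) : Prop :=
  forall U, submodule U -> (forall s, S s -> U s) -> U v.

Variable S : V -> Prop.

Lemma span_gen v : S v -> span S v.
Proof. by move=> Sv U _; apply. Qed.

Lemma span_submodule : submodule (span S).
Proof.
split=> [U [U0 _] _ //|a u v Su Sv U sU SU].
by apply: sU.2; [apply: Su | apply: Sv].
Qed.

Lemma span0 : span S 0. Proof. exact: span_submodule.1. Qed.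

Lemma spanD u v : span S u -> span S v -> span S (u + v).
Proof.
by move=> Su Sv; rewrite -[u]scale1r; apply: span_submodule.2.
Qed.

Lemma spanZ a u : span S u -> span S (a *: u).
Proof.
by move=> Su; rewrite -[_ *: _]addr0; apply: span_submodule.2 => //; apply: span0.
Qed.

Lemma spanN u : span S u -> span S (- u).
Proof. by move=> Su; rewrite -scaleN1r; apply: spanZ. Qed.

Lemma spanB u v : span S u -> span S v -> span S (u - v).
Proof. by move=> Su Sv; apply: spanD => //; apply: spanN. Qed.

End Span.

Section Quotient.
Variables (k : pzRingType) (V : lmodType k) (S : V -> Prop).

Definition quot_rel (u v : V) : bool := `[< span S (u - v) >].

Lemma quot_relP : equiv_class_of quot_rel.
Proof.
split.
- by move=> u; apply/asboolP; rewrite subrr; apply: span0.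
- by move=> u v; apply: asbool_equiv_eq; split=> H; rewrite -opprB; apply: spanN.
- move=> v u w /asboolP H1 /asboolP H2; apply/asboolP.
  by rewrite -(subrKA v); apply: spanD.
Qed.

Canonical quot_equiv := EquivRelPack quot_relP.
Canonical quot_equiv_direct := defaultEncModRel quot_rel.

(* The quotient of V by the submodule spanned by S. *)
Definition quot : Type := {eq_quot quot_rel}.

HB.instance Definition _ : EqQuotient _ quot_rel quot := EqQuotient.on quot.
HB.instance Definition _ := Choice.on quot.

End Quotient.

HB.lock
Definition qpi (k : pzRingType) (V : lmodType k) (S : V -> Prop) (v : V) : quot S :=
  \pi_(quot S) v.
Canonical qpi_unlockable := Unlockable qpi.unlock.

Section QuotientTheory.
Variables (k : pzRingType) (V : lmodType k) (S : V -> Prop).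

Local Notation quot := (quot S).
Local Notation qpi := (qpi S).

Lemma qpiP u v : (qpi u = qpi v) <-> span S (u - v).
Proof.
split; first by move/eqP; rewrite unlock eqmodE => /asboolP.
by move=> H; apply/eqP; rewrite unlock eqmodE; apply/asboolP.
Qed.

Lemma qpiK (x : quot) : qpi (repr x) = x. Proof. by rewrite unlock reprK. Qed.

Lemma reprB v : span S (repr (qpi v) - v).
Proof. by apply/qpiP; rewrite qpiK. Qed.

Definition quot_zero := qpi 0.
Definition quot_opp (x : quot) := qpi (- repr x).
Definition quot_add (x y : quot) := qpi (repr x + repr y).
Definition quot_scale a (x : quot) := qpi (a *: repr x).

Lemma quot_oppE u : quot_opp (qpi u) = qpi (- u).
Proof. by apply/qpiP; rewrite -opprD; apply: spanN; apply: reprB. Qed.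

Lemma quot_addE u v : quot_add (qpi u) (qpi v) = qpi (u + v).
Proof. by apply/qpiP; rewrite opprD addrACA; apply: spanD; apply: reprB. Qed.

Lemma quot_scaleE a u : quot_scale a (qpi u) = qpi (a *: u).
Proof. by apply/qpiP; rewrite -scalerBr; apply: spanZ; apply: reprB. Qed.

Lemma qind (P : quot -> Prop) : (forall v, P (qpi v)) -> forall x, P x.
Proof. by move=> H x; rewrite -(qpiK x). Qed.

Lemma quot_addA : associative quot_add.
Proof.
by elim/qind=> u; elim/qind=> v; elim/qind=> w; rewrite !quot_addE addrA.
Qed.
Lemma quot_addC : commutative quot_add.
Proof. by elim/qind=> u; elim/qind=> v; rewrite !quot_addE addrC. Qed.
Lemma quot_add0 : left_id quot_zero quot_add.
Proof. by elim/qind=> u; rewrite quot_addE add0r. Qed.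
Lemma quot_addN : left_inverse quot_zero quot_opp quot_add.
Proof. by elim/qind=> u; rewrite quot_oppE quot_addE addNr. Qed.

HB.instance Definition _ :=
  GRing.isZmodule.Build quot quot_addA quot_addC quot_add0 quot_addN.

Let qpi_addE u v : qpi u + qpi v = qpi (u + v).
Proof. exact: quot_addE. Qed.

Lemma quot_scaleA a b x : quot_scale a (quot_scale b x) = quot_scale (a * b) x.
Proof. by elim/qind: x => u; rewrite !quot_scaleE scalerA. Qed.
Lemma quot_scale1 : left_id 1 quot_scale.
Proof. by elim/qind=> u; rewrite quot_scaleE scale1r. Qed.
Lemma quot_scaleDr : right_distributive quot_scale +%R.
Proof.
move=> a; elim/qind=> u; elim/qind=> v.
by rewrite qpi_addE !quot_scaleE qpi_addE scalerDr.
Qed.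
Lemma quot_scaleDl x : {morph quot_scale^~ x : a b / a + b}.
Proof.
move=> a b; elim/qind: x => u.
by rewrite !quot_scaleE qpi_addE scalerDl.
Qed.

HB.instance Definition _ := GRing.Zmodule_isLmodule.Build k quot
  quot_scaleA quot_scale1 quot_scaleDr quot_scaleDl.

Lemma qpi_is_linear : linear qpi.
Proof. by move=> a u v; rewrite -qpi_addE -quot_scaleE. Qed.
HB.instance Definition _ := GRing.isLinear.Build k V quot _ qpi qpi_is_linear.

End QuotientTheory.



Lemma linear_prop0 (R : pzRingType) (U W : lmodType R) (f : U -> W) :
  linear f -> f 0 = 0.
Proof. by move=> lf; have := lf (-1) 0 0; rewrite scaler0 addr0 scaleN1r addNr. Qed.

Lemma linear_comb (k : comPzRingType) (U W : lmodType k) (f g : U -> W) c :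
  linear f -> linear g -> linear (fun x => c *: f x + g x).
Proof.
move=> lf lg a u v; rewrite lf lg scalerDr !scalerDr !scalerA [c * a]mulrC.
by rewrite addrACA.
Qed.

(* The map induced by f on the quotient, when f is linear and vanishes on S. *)
HB.lock
Definition qlift (k : pzRingType) (V W : lmodType k) (S : V -> Prop)
  (f : V -> W) (x : quot S) : W := f (repr x).
Canonical qlift_unlockable := Unlockable qlift.unlock.

(* The linear extension of f along the basis t |-> << t >>. *)
HB.lock
Definition flift (R : nzRingType) (T : choiceType) (W : lmodType R) (f : T -> W)
  (g : {malg R[T]}) : W := \sum_(t <- msupp g) g@_t *: f t.
Canonical flift_unlockable := Unlockable flift.unlock.

Section QuotientLift.
Variables (k : pzRingType) (V W : lmodType k) (S : V -> Prop).

Lemma qliftE (f : V -> W) v :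
  linear f -> (forall s, S s -> f s = 0) -> qlift f (qpi S v) = f v.
Proof.
move=> lf f0; have f0' w : span S w -> f w = 0.
  move/(_ (fun u => f u = 0)); apply=> //; split=> [|a u u' fu fu'].
    exact: linear_prop0.
  by rewrite lf fu fu' scaler0 addr0.
have := f0' _ (reprB v); rewrite [qlift]unlock addrC -scaleN1r lf scaleN1r addrC.
by move/eqP; rewrite subr_eq0 => /eqP.
Qed.

End QuotientLift.

Section Free.
Variables (R : nzRingType) (T : choiceType).

Lemma malg_ind (P : {malg R[T]} -> Prop) :
  submodule P -> (forall t, P << t >>) -> forall g, P g.
Proof.
move=> [P0 PZ] PU g; rewrite (monalgE g).
elim/big_rec: _ => // t h _ Ph.
suff -> : << g@_t *g t >> = g@_t *: << t >> :> {malg R[T]} by apply: PZ.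
by apply/malgP=> t'; rewrite !mcoeffsE mulrnAr mulr1.
Qed.

Variable W : lmodType R.

Lemma malg_eq (f g : {malg R[T]} -> W) :
  linear f -> linear g -> (forall t, f << t >> = g << t >>) -> f =1 g.
Proof.
move=> lf lg; apply: malg_ind; split=> [|a u v fu fv].
  by rewrite !linear_prop0.
by rewrite lf lg fu fv.
Qed.

Lemma fliftw (f : T -> W) (d : {fset T}) g : (msupp g `<=` d)%fset ->
  flift f g = \sum_(t <- d) g@_t *: f t.
Proof.
move=> le; rewrite [flift]unlock; apply: big_fset_incl => // t _.
by move/mcoeff_outdom=> ->; rewrite scale0r.
Qed.

Lemma flift_linear (f : T -> W) : linear (flift f).
Proof.
move=> a u v; pose d := (msupp u `|` (msupp v `|` msupp (a *: u + v)))%fset.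
rewrite !(@fliftw f d) ?fsubsetUl //.
- rewrite scaler_sumr -big_split /=; apply: eq_bigr => t _.
  by rewrite mcoeffD mcoeffZ scalerDl scalerA.
- by rewrite /d fsetUCA fsubsetUl.
- by rewrite /d fsetUA fsubsetUr.
Qed.

HB.instance Definition _ (f : T -> W) :=
  GRing.isLinear.Build R {malg R[T]} W _ (flift f) (flift_linear f).

Lemma fliftU (f : T -> W) t : flift f << t >> = f t.
Proof.
by rewrite [flift]unlock msuppU oner_eq0 big_seq_fset1 mcoeffUU scale1r.
Qed.

End Free.

Section Tensor.
Variables (k : comNzRingType) (M N : zmodType) (I : Type).
Variables (sc : k -> M -> M) (actM : M -> I -> M) (actN : I -> N -> N).

Inductive tensor_rel : {malg k[(M * N)%type]} -> Prop :=
| tensor_rel_addl m m' n :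
    tensor_rel (<< (m + m', n) >> - << (m, n) >> - << (m', n) >>)
| tensor_rel_addr m n n' :
    tensor_rel (<< (m, n + n') >> - << (m, n) >> - << (m, n') >>)
| tensor_rel_scale c m n :
    tensor_rel (<< (sc c m, n) >> - c *: << (m, n) >>)
| tensor_rel_act m i n :
    tensor_rel (<< (actM m i, n) >> - << (m, actN i n) >>).

(* The k-module generated by the symbols m (x) n, additive in m and in n, with
   (c m) (x) n = c (m (x) n) for c in k and (m . i) (x) n = m (x) (i . n) for
   i in I. *)
Definition tensor : Type := quot tensor_rel.

HB.instance Definition _ := GRing.Lmodule.on tensor.

End Tensor.

HB.lock
Definition pure (k : comNzRingType) (M N : zmodType) (I : Type)
    (sc : k -> M -> M) (actM : M -> I -> M) (actN : I -> N -> N)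
    (m : M) (n : N) : tensor sc actM actN :=
  qpi (tensor_rel sc actM actN) << (m, n) >>.
Canonical pure_unlockable := Unlockable pure.unlock.

Section TensorTheory.
Variables (k : comNzRingType) (M N : zmodType) (I : Type).
Variables (sc : k -> M -> M) (actM : M -> I -> M) (actN : I -> N -> N).

Local Notation tensor := (tensor sc actM actN).
Local Notation tensor_rel := (tensor_rel sc actM actN).
Local Notation pure := (pure sc actM actN).

Let pureE m n : pure m n = qpi tensor_rel << (m, n) >>.
Proof. by rewrite unlock. Qed.

Definition balanced (W : lmodType k) (f : M -> N -> W) : Prop :=
  [/\ forall m m' n, f (m + m') n = f m n + f m' n,
      forall m n n', f m (n + n') = f m n + f m n',
      forall c m n, f (sc c m) n = c *: f m n &
      forall m i n, f (actM m i) n = f m (actN i n)].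

Lemma pure_balanced : balanced pure.
Proof.
have E x y : tensor_rel (x - y) -> qpi tensor_rel x = qpi tensor_rel y.
  by move=> H; apply/qpiP; apply: span_gen.
split=> [m m' n|m n n'|c m n|m i n].
- by rewrite !pureE -linearD; apply: E; rewrite opprD addrA; apply: tensor_rel_addl.
- by rewrite !pureE -linearD; apply: E; rewrite opprD addrA; apply: tensor_rel_addr.
- by rewrite !pureE -linearZ; apply: E; apply: tensor_rel_scale.
- by rewrite !pureE; apply: E; apply: tensor_rel_act.
Qed.

Lemma pureDl m m' n : pure (m + m') n = pure m n + pure m' n.
Proof. by case: pure_balanced. Qed.
Lemma pureDr m n n' : pure m (n + n') = pure m n + pure m n'.
Proof. by case: pure_balanced. Qed.
Lemma pureZ c m n : pure (sc c m) n = c *: pure m n.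
Proof. by case: pure_balanced. Qed.
Lemma pureA m i n : pure (actM m i) n = pure m (actN i n).
Proof. by case: pure_balanced. Qed.

Lemma tensor_ind (P : tensor -> Prop) :
  submodule P -> (forall m n, P (pure m n)) -> forall x, P x.
Proof.
move=> [P0 PZ] PU; elim/qind=> g.
elim/malg_ind: g => [|[m n]]; last by have := PU m n; rewrite !pureE.
by split=> [|a u v Pu Pv]; rewrite ?linear0 // linearP; apply: PZ.
Qed.

Lemma tensor_eq (W : lmodType k) (f g : tensor -> W) : linear f -> linear g ->
  (forall m n, f (pure m n) = g (pure m n)) -> f =1 g.
Proof.
move=> lf lg; apply: tensor_ind; split=> [|a u v fu fv].
  by rewrite !linear_prop0.
by rewrite lf lg fu fv.
Qed.

(* The map m (x) n |-> f m n when f is balanced. *)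
Definition tlift (W : lmodType k) (f : M -> N -> W) : tensor -> W :=
  qlift (flift (fun t => f t.1 t.2)).

Section Lift.
Variables (W : lmodType k) (f : M -> N -> W).
Hypothesis fb : balanced f.

Let lf := flift_linear (fun t => f t.1 t.2).

Lemma flift_tensor_rel s : tensor_rel s -> flift (fun t => f t.1 t.2) s = 0.
Proof.
case: fb => f1 f2 f3 f4.
case=> [m m' n|m n n'|c m n|m i n].
- by rewrite !linearB /= !fliftU /= f1 addrAC addrK subrr.
- by rewrite !linearB /= !fliftU /= f2 addrAC addrK subrr.
- by rewrite linearB /= linearZ /= !fliftU /= f3 subrr.
- by rewrite linearB /= !fliftU /= f4 subrr.
Qed.

Lemma tlift_pure m n : tlift f (pure m n) = f m n.
Proof.
by rewrite /tlift pureE qliftE ?fliftU //; apply: flift_tensor_rel.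
Qed.

Lemma tlift_linear : linear (tlift f).
Proof.
move=> a; elim/qind=> u; elim/qind=> v.
by rewrite -linearP /tlift !(qliftE _ lf flift_tensor_rel) lf.
Qed.

End Lift.
End TensorTheory.

Section Enveloping.
Variables (k : comNzRingType) (C : algType k).

(* The ring C (x)_k C^op. *)
Definition env : Type :=
  @tensor k C C^c k *:%R (fun a c => c *: a) (fun c b => c *: (b : C)).

HB.instance Definition _ := GRing.Lmodule.on env.

Definition epure (a : C) (b : C^c) : env := pure _ _ _ a b.

Lemma epureZl c a b : epure (c *: a) b = c *: epure a b.
Proof. exact: pureZ. Qed.
Lemma epureZr c a (b : C) : epure a (c *: b) = c *: epure a b.
Proof. by rewrite -epureZl; symmetry; exact: pureA. Qed.

Local Notation ebalanced W := (@balanced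
  k C C^c k *:%R (fun a c => c *: a) (fun c b => c *: (b : C)) W).

Lemma env_balanced (W : lmodType k) (f : C -> C^c -> W) :
  (forall b, linear (f^~ b)) -> (forall a, linear (f a : C -> W)) ->
  ebalanced W f.
Proof.
move=> fl fr.
have fZl c a b : f (c *: a) b = c *: f a b.
  have := fl b c a 0; rewrite /= addr0.
  by rewrite (linear_prop0 (fl b)) addr0.
have fZr c a (b : C) : f a (c *: b) = c *: f a b.
  have := fr a c b 0; rewrite /= addr0.
  by rewrite (linear_prop0 (fr a)) addr0.
split=> [a a' b|a b b'|c a b|a c b] //.
- by have := fl b 1 a a'; rewrite /= !scale1r.
- by have := fr a 1 b b'; rewrite /= !scale1r.
- by rewrite fZl fZr.
Qed.

Lemma epure_linl b : linear (epure^~ b).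
Proof. by move=> c a a'; rewrite -epureZl; exact: pureDl. Qed.
Lemma epure_linr a : linear (epure a : C -> env).
Proof. by move=> c b b'; rewrite -epureZr; exact: pureDr. Qed.

(* (a (x) b) (a' (x) b') = a a' (x) b b', where b b' is the product in C^c, that
   is, b' b in C. *)
Definition env_mul (u v : env) : env :=
  tlift (fun a b => tlift (fun a' (b' : C^c) => epure (a * a') (b * b')) v) u.
Definition env_one : env := epure 1 1.

Lemma env_ind (P : env -> Prop) :
  submodule P -> (forall a b, P (epure a b)) -> forall x, P x.
Proof. exact: tensor_ind. Qed.

Lemma env_eq (W : lmodType k) (f g : env -> W) : linear f -> linear g ->
  (forall a b, f (epure a b) = g (epure a b)) -> f =1 g.
Proof. exact: tensor_eq. Qed.

Lemma env_mul_inner a (b : C^c) :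
  ebalanced env
    (fun a' (b' : C^c) => epure (a * a') (b * b')).
Proof.
apply: env_balanced => [b' c x y|a' c x y].
- by rewrite mulrDr -scalerAr epure_linl.
- rewrite [X in epure _ X](_ : _ = c *: ((x : C) * (b : C)) + (y : C) * (b : C)).
    by rewrite epure_linr.
  by rewrite -[RHS]/(c *: (x * (b : C)) + y * (b : C)) scalerAl -mulrDl.
Qed.

Lemma env_mul_outer (v : env) :
  ebalanced env
    (fun a b => tlift (fun a' (b' : C^c) => epure (a * a') (b * b')) v).
Proof.
apply: env_balanced => [b c x y|a c x y]; move: v; apply: env_eq.
- exact: tlift_linear (env_mul_inner _ _).
- by apply: linear_comb; exact: tlift_linear (env_mul_inner _ _).
- move=> a' b'; rewrite !tlift_pure; try exact: env_mul_inner.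
  by rewrite mulrDl -scalerAl epure_linl.
- exact: tlift_linear (env_mul_inner _ _).
- by apply: linear_comb; exact: tlift_linear (env_mul_inner _ _).
- move=> a' b'; rewrite !tlift_pure; try exact: env_mul_inner.
  rewrite [X in epure _ X](_ : _ = c *: ((b' : C) * (x : C)) + (b' : C) * (y : C)).
    by rewrite epure_linr.
  by rewrite scalerAr -mulrDr.
Qed.

Let env_mulE a b v : env_mul (epure a b) v =
  tlift (fun a' (b' : C^c) => epure (a * a') (b * b')) v.
Proof. exact: (tlift_pure (env_mul_outer v)). Qed.

Lemma env_mul_pure a b a' b' :
  env_mul (epure a b) (epure a' b') = epure (a * a') (b * b').
Proof.
rewrite env_mulE; exact: (tlift_pure (env_mul_inner _ _)).
Qed.

Lemma env_mul_linl v : linear (env_mul^~ v).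
Proof. exact: tlift_linear (env_mul_outer v). Qed.

Lemma env_mul_linr u : linear (env_mul u).
Proof.
move=> c x y; move: u; apply: env_eq; first exact: env_mul_linl.
  by apply: linear_comb; exact: env_mul_linl.
move=> a b; rewrite !env_mulE.
exact: tlift_linear (env_mul_inner _ _) _ _ _.
Qed.

Lemma env_mulA : associative env_mul.
Proof.
move=> x y z; move: x; apply: env_eq.
- exact: env_mul_linl.
- by move=> c u v; rewrite !env_mul_linl.
move=> a b; move: y; apply: env_eq.
- by move=> c u v; rewrite env_mul_linl env_mul_linr.
- by move=> c u v; rewrite env_mul_linr env_mul_linl.
move=> a' b'; move: z; apply: env_eq.
- by move=> c u v; rewrite !env_mul_linr.
- exact: env_mul_linr.
by move=> a'' b''; rewrite !env_mul_pure !mulrA.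
Qed.

Lemma env_mul1 : left_id env_one env_mul.
Proof.
apply: env_eq; [exact: env_mul_linr|by []|move=> a b].
by rewrite env_mul_pure !mul1r.
Qed.

Lemma env_mulr1 : right_id env_one env_mul.
Proof.
apply: env_eq; [exact: env_mul_linl|by []|move=> a b].
by rewrite env_mul_pure !mulr1.
Qed.

Lemma env_mulDl : left_distributive env_mul +%R.
Proof. by move=> u v w; rewrite -[u]scale1r env_mul_linl !scale1r. Qed.

Lemma env_mulDr : right_distributive env_mul +%R.
Proof. by move=> u v w; rewrite -[v]scale1r env_mul_linr !scale1r. Qed.

Lemma env_mulZl c u v : c *: env_mul u v = env_mul (c *: u) v.
Proof.
by rewrite -[c *: u]addr0 env_mul_linl (linear_prop0 (env_mul_linl v)) addr0.
Qed.

Lemma env_mulZr c u v : c *: env_mul u v = env_mul u (c *: v).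
Proof.
by rewrite -[c *: v]addr0 env_mul_linr (linear_prop0 (env_mul_linr u)) addr0.
Qed.

(* C is a left and a right module over C (x)_k C^op by
   (a (x) b) . c = a c b  and  c . (a (x) b) = b c a. *)
Definition env_lact (u : env) (c : C) : C :=
  tlift (fun a (b : C^c) => a * c * (b : C)) u.
Definition env_ract (u : env) (c : C) : C :=
  tlift (fun a (b : C^c) => (b : C) * c * a) u.

Lemma env_lact_balanced c :
  ebalanced C
    (fun a (b : C^c) => a * c * (b : C)).
Proof.
apply: env_balanced => [b x a a'|a x b b'].
- by rewrite !mulrDl -!scalerAl.
- by rewrite mulrDr -scalerAr.
Qed.

Lemma env_ract_balanced c :
  ebalanced C
    (fun a (b : C^c) => (b : C) * c * a).
Proof.
apply: env_balanced => [b x a a'|a x b b'].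
- by rewrite mulrDr -scalerAr.
- by rewrite !mulrDl -!scalerAl.
Qed.

Lemma env_lact_pure a b c : env_lact (epure a b) c = a * c * (b : C).
Proof. exact: (tlift_pure (env_lact_balanced c)). Qed.

Lemma env_ract_pure a b c : env_ract (epure a b) c = (b : C) * c * a.
Proof. exact: (tlift_pure (env_ract_balanced c)). Qed.

Lemma env_lact_lin c : linear (env_lact^~ c).
Proof. exact: tlift_linear (env_lact_balanced c). Qed.

Lemma env_ract_lin c : linear (env_ract^~ c).
Proof. exact: tlift_linear (env_ract_balanced c). Qed.

Lemma env_one_neq0 : env_one != 0.
Proof.
apply/eqP=> /(congr1 (env_lact^~ 1)); rewrite (linear_prop0 (env_lact_lin 1)).
by rewrite env_lact_pure !mulr1 => /eqP; rewrite oner_eq0.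
Qed.

HB.instance Definition _ := GRing.Zmodule_isNzRing.Build env
  env_mulA env_mul1 env_mulr1 env_mulDl env_mulDr env_one_neq0.
HB.instance Definition _ := GRing.Lmodule_isLalgebra.Build k env env_mulZl.
HB.instance Definition _ := GRing.Lalgebra_isAlgebra.Build k env env_mulZr.

Lemma env_lactA u v c : env_lact u (env_lact v c) = env_lact (u * v) c.
Proof.
move: u; apply: env_eq; first exact: env_lact_lin.
  by move=> x u w; rewrite mulrDl -scalerAl env_lact_lin.
move=> a b; move: v; apply: env_eq.
- move=> x u w; rewrite env_lact_lin !env_lact_pure.
  by rewrite mulrDr mulrDl -scalerAr -scalerAl.
- by move=> x u w; rewrite mulrDr -scalerAr env_lact_lin.
move=> a' b'; rewrite -[epure a b * _]/(env_mul _ _) env_mul_pure !env_lact_pure.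
by rewrite -[b * b']/((b' : C) * (b : C)) !mulrA.
Qed.

Lemma env_lact1 c : env_lact 1 c = c.
Proof. by rewrite env_lact_pure mul1r mulr1. Qed.

Lemma env_lactDr u : {morph env_lact u : c d / c + d}.
Proof.
move=> c d; move: u; apply: env_eq; first exact: env_lact_lin.
  by move=> x u w; rewrite !env_lact_lin scalerDr addrACA.
by move=> a b; rewrite !env_lact_pure mulrDr mulrDl.
Qed.

Lemma env_lactDl c : {morph env_lact^~ c : u v / u + v}.
Proof. by move=> u v; rewrite -[u]scale1r env_lact_lin !scale1r. Qed.

Lemma env_ractA u v c : env_ract u (env_ract v c) = env_ract (v * u) c.
Proof.
move: u; apply: env_eq; first exact: env_ract_lin.
  by move=> x u w; rewrite mulrDr -scalerAr env_ract_lin.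
move=> a b; move: v; apply: env_eq.
- move=> x u w; rewrite env_ract_lin !env_ract_pure.
  by rewrite mulrDr mulrDl -scalerAr -scalerAl.
- by move=> x u w; rewrite mulrDl -scalerAl env_ract_lin.
move=> a' b'; rewrite -[_ * epure a b]/(env_mul _ _) env_mul_pure !env_ract_pure.
by rewrite -[b' * b]/((b : C) * (b' : C)) !mulrA.
Qed.

Lemma env_ract1 c : env_ract 1 c = c.
Proof. by rewrite env_ract_pure mul1r mulr1. Qed.

Lemma env_ractDr u : {morph env_ract u : c d / c + d}.
Proof.
move=> c d; move: u; apply: env_eq; first exact: env_ract_lin.
  by move=> x u w; rewrite !env_ract_lin scalerDr addrACA.
by move=> a b; rewrite !env_ract_pure mulrDr mulrDl.
Qed.

Lemma env_ractDl c : {morph env_ract^~ c : u v / u + v}.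
Proof. by move=> u v; rewrite -[u]scale1r env_ract_lin !scale1r. Qed.

Definition left_reg : Type := C.
HB.instance Definition _ := GRing.Zmodule.on left_reg.
HB.instance Definition _ := GRing.Zmodule_isLmodule.Build env left_reg
  env_lactA env_lact1 env_lactDr env_lactDl.

Definition right_reg : Type := C.
HB.instance Definition _ := GRing.Zmodule.on right_reg.
HB.instance Definition _ := GRing.Zmodule_isLmodule.Build env^c right_reg
  env_ractA env_ract1 env_ractDr env_ractDl.

End Enveloping.

Section Kernel.
Variables (R : pzRingType) (V W : lmodType R) (f : {linear V -> W}).

Definition ker_pred : {pred V} := [pred v | f v == 0].

Fact ker_closed : submod_closed ker_pred.
Proof.
split=> [|a u v]; rewrite !inE ?linear0 // => /eqP fu /eqP fv.
by rewrite linearP fu fv scaler0 addr0.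
Qed.

HB.instance Definition _ := GRing.isSubmodClosed.Build R V ker_pred ker_closed.

Record ker : Type := Ker { ker_val : V; _ : ker_val \in ker_pred }.

HB.instance Definition _ := [isSub for ker_val].
HB.instance Definition _ := [Choice of ker by <:].
HB.instance Definition _ := [SubChoice_isSubLmodule of ker by <:].

End Kernel.

(* ker g / im f; only meaningful when g \o f = 0. *)
Definition homology (R : pzRingType) (U V W : lmodType R)
    (f : {linear U -> V}) (g : {linear V -> W}) : lmodType R :=
  quot (fun z : ker g => exists u, val z = f u).

(* The canonical free resolution of N: its term of degree n is the free module
   on the underlying set of the n-th syzygy, where the 0-th syzygy is N and the
   next one is the kernel of the evaluation map from the free module on the
   previous one. *)
Section FreeResolution.
Variables (A : nzRingType) (N : lmodType A).

Definition free_eval (M : lmodType A) : {linear {malg A[M]} -> M} :=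
  flift (fun m : M => m).

Fixpoint syzygy (n : nat) : lmodType A :=
  if n is p.+1 then ker (free_eval (syzygy p)) else N.

Definition free_res (n : nat) : lmodType A := {malg A[syzygy n]}.

Definition free_res_diff (n : nat) : {linear free_res n.+1 -> free_res n} :=
  (val : syzygy n.+1 -> free_res n) \o free_eval (syzygy n.+1).

Lemma free_eval_surj (M : lmodType A) (m : M) : exists x, free_eval M x = m.
Proof. by exists << m >>; exact: fliftU. Qed.

Lemma free_res_exact0 x :
  free_eval N x = 0 <-> exists y, x = free_res_diff 0 y.
Proof.
split=> [x0|[y ->]]; last by apply/eqP; exact: valP (free_eval (syzygy 1) y).
have Kx : x \in ker_pred (free_eval N) by rewrite inE x0.
by have [y Ey] := free_eval_surj (Ker Kx : syzygy 1); exists y; rewrite /= Ey.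
Qed.

Lemma free_res_exactS n x :
  free_res_diff n x = 0 <-> exists y, x = free_res_diff n.+1 y.
Proof.
split=> [x0|[y ->]].
  have Kx : x \in ker_pred (free_eval (syzygy n.+1)).
    by rewrite inE; apply/eqP/val_inj; rewrite linear0.
  by have [y Ey] := free_eval_surj (Ker Kx : syzygy n.+2); exists y; rewrite /= Ey.
have /eqP E := valP (free_eval (syzygy n.+2) y).
exact: (etrans (congr1 val E) (linear0 _)).
Qed.

End FreeResolution.

Section Tor.
Variables (k : comNzRingType) (A : algType k) (M : lmodType A^c).

(* M (x)_A N as a k-module, for a right A-module M and a left A-module N. *)
Definition tens (N : lmodType A) : lmodType k :=
  @tensor k M N A (fun c m => (c%:A : A^c) *: m) (fun m a => (a : A^c) *: m) *:%R.

Section Map.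
Variables (N N' : lmodType A) (g : {linear N -> N'}).

Lemma tens_map_balanced :
  @balanced k M N A (fun c m => (c%:A : A^c) *: m) (fun m a => (a : A^c) *: m)
    *:%R (tens N') (fun m n => pure _ _ _ m (g n)).
Proof.
split=> *; rewrite ?linearD ?linearZ.
- exact: pureDl.
- exact: pureDr.
- exact: pureZ.
- exact: pureA.
Qed.

(* The map m (x) n |-> m (x) g n. *)
Definition tens_map : tens N -> tens N' := tlift (fun m n => pure _ _ _ m (g n)).

HB.instance Definition _ := GRing.isLinear.Build k (tens N) (tens N') _ tens_map
  (tlift_linear tens_map_balanced).

End Map.

Variable N : lmodType A.

Definition tor_term (n : nat) : lmodType k := tens (free_res N n).

Definition tor_diff (n : nat) : {linear tor_term n -> tor_term n.-1} :=
  if n is p.+1 return {linear tor_term n -> tor_term n.-1}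
  then tens_map (free_res_diff N p) else \0.

Lemma tor_diff_diff n x : tor_diff n.+1 (tor_diff n.+2 x) = 0.
Proof.
move: x; apply: tensor_ind; first split.
- by rewrite !linear0.
- by move=> a u v Hu Hv; rewrite !linearP Hu Hv /= scaler0 addr0.
move=> m y; rewrite /= /tens_map !tlift_pure; try exact: tens_map_balanced.
rewrite (_ : free_res_diff N n (free_res_diff N n.+1 y) = 0).
  by apply: (@addrI _ (pure _ _ _ m 0)); rewrite addr0 -pureDr addr0.
by apply/free_res_exactS; exists y.
Qed.

Definition Tor (n : nat) : lmodType k := homology (tor_diff n.+1) (tor_diff n).

End Tor.

Definition HH (k : comNzRingType) (C : algType k) (n : nat) : lmodType k :=
  Tor (right_reg C) (left_reg C) n.

(* The monomial x^i y^j, where s = (i, j), in k[x] (x) k[y, y^-1]. *)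
HB.lock
Definition xy (k : fieldType) (s : nat * int) : {malg k[(nat * int)%type]} := << s >>.
Canonical xy_unlockable := Unlockable xy.unlock.

Section QuantumCylinder.
Variables (k : fieldType) (q : k).

Local Notation xy := (xy k).

Let xyE s : xy s = << s >>. Proof. by rewrite unlock. Qed.

Definition qcyl (q0 : q != 0) : Type := {malg k[(nat * int)%type]}.

(* The bilinear product with (x^i y^j) (x^i' y^j') = q^(j i') x^(i+i') y^(j+j').
   It is associative only for q != 0, because 0 ^ z = 0 for z < 0. *)
Definition qmul (u v : {malg k[(nat * int)%type]}) : {malg k[(nat * int)%type]} :=
  flift (fun s => flift (fun t =>
    q ^ (s.2 * t.1%:Z) *: xy ((s.1 + t.1)%N, s.2 + t.2)) v) u.

Definition qone : {malg k[(nat * int)%type]} := xy (0%N, 0).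

Lemma xy_eq (W : lmodType k) (f g : {malg k[(nat * int)%type]} -> W) :
  linear f -> linear g -> (forall i j, f (xy (i, j)) = g (xy (i, j))) -> f =1 g.
Proof.
by move=> lf lg fg; apply: malg_eq => // -[i j]; have := fg i j; rewrite unlock.
Qed.

Lemma qmulE i j i' j' :
  qmul (xy (i, j)) (xy (i', j')) = q ^ (j * i'%:Z) *: xy ((i + i')%N, j + j').
Proof. by rewrite /qmul [xy (i, j)]xyE fliftU [xy (i', j')]xyE fliftU. Qed.

Lemma qmul_linl v : linear (qmul^~ v).
Proof. exact: flift_linear. Qed.

Lemma qmul_linr u : linear (qmul u).
Proof.
move=> c x y; move: u; apply: malg_eq.
- exact: qmul_linl.
- by apply: linear_comb; exact: qmul_linl.
- by move=> s; rewrite /qmul !fliftU flift_linear.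
Qed.

Lemma qmulZl c u v : c *: qmul u v = qmul (c *: u) v.
Proof.
by rewrite -[c *: u]addr0 qmul_linl (linear_prop0 (qmul_linl v)) addr0.
Qed.

Lemma qmulZr c u v : c *: qmul u v = qmul u (c *: v).
Proof.
by rewrite -[c *: v]addr0 qmul_linr (linear_prop0 (qmul_linr u)) addr0.
Qed.

Lemma qmul1 : left_id qone qmul.
Proof.
apply: xy_eq => [||i j]; [exact: qmul_linr|by []|].
by rewrite qmulE mul0r expr0z scale1r add0n add0r.
Qed.

Lemma qmulr1 : right_id qone qmul.
Proof.
apply: xy_eq => [||i j]; [exact: qmul_linl|by []|].
by rewrite qmulE mulr0 expr0z scale1r addn0 addr0.
Qed.

Lemma qmulDl : left_distributive qmul +%R.
Proof. by move=> u v w; rewrite -[u]scale1r qmul_linl !scale1r. Qed.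

Lemma qmulDr : right_distributive qmul +%R.
Proof. by move=> u v w; rewrite -[v]scale1r qmul_linr !scale1r. Qed.

Lemma qone_neq0 : qone != 0.
Proof. by rewrite /qone unlock monalgU_eq0 oner_neq0. Qed.

Section Ring.
Hypothesis q0 : q != 0.

Lemma qmulA : associative qmul.
Proof.
move=> x y z; move: x; apply: xy_eq.
- exact: qmul_linl.
- by move=> c u v; rewrite !qmul_linl.
move=> i j; move: y; apply: xy_eq.
- by move=> c u v; rewrite qmul_linl qmul_linr.
- by move=> c u v; rewrite qmul_linr qmul_linl.
move=> i' j'; move: z; apply: xy_eq.
- by move=> c u v; rewrite 2!qmul_linr.
- exact: qmul_linr.
move=> i'' j''; rewrite 2!qmulE -qmulZl -qmulZr 2!qmulE 2!scalerA addnA addrA.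
congr (_ *: _).
rewrite -[LHS](expfzDr _ _ q0) -[RHS](expfzDr _ _ q0); congr (q ^ _).
by rewrite PoszD mulrDl mulrDr addrCA; congr (_ + _); exact: addrC.
Qed.

HB.instance Definition _ := GRing.Lmodule.on (qcyl q0).
HB.instance Definition _ := GRing.Zmodule_isNzRing.Build (qcyl q0)
  qmulA qmul1 qmulr1 qmulDl qmulDr qone_neq0.
HB.instance Definition _ := GRing.Lmodule_isLalgebra.Build k (qcyl q0) qmulZl.
HB.instance Definition _ := GRing.Lalgebra_isAlgebra.Build k (qcyl q0) qmulZr.

Lemma qcyl_yx i j : (xy (0%N, j) : qcyl q0) * (xy (i, 0) : qcyl q0) =
  q ^ (i%:Z * j) *: ((xy (i, 0) : qcyl q0) * (xy (0%N, j) : qcyl q0)).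
Proof.
rewrite -[LHS]/(qmul _ _) -[X in _ *: X]/(qmul _ _) 2!qmulE mul0r expr0z scale1r.
by rewrite add0n addn0 add0r addr0 mulrC.
Qed.

End Ring.
End QuantumCylinder.

(* The k-module k[y, y^-1], with the basis of the y^j, j in Z. *)
Definition laurent (k : fieldType) : lmodType k := {malg k[int]}.

Definition lin_iso (k : pzRingType) (V W : lmodType k) : Prop :=
  exists f : {linear V -> W}, bijective f.

(* Main.v *)
From HB Require Import structures.
From mathcomp Require Import all_boot all_algebra.
From mathcomp Require Import boolp.
From mathcomp Require Import finmap monalg.
Require Import Defs.

(** Write [C] for the quantum cylinder and [E] for its enveloping algebra
    [C (x) C^op], with elements [a (x) b].  The homology [HH_n(C)] is defined by
    the canonical free resolution of [C] over [E]; by the comparison theorem for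
    projective resolutions ([tens_equivalence], [Tor_iso]) every projective
    resolution computes it, and a Koszul resolution of length 2 is available:
<<
      0 -> E e_xy -> E e_x (+) E e_y -> E -> C -> 0,
      e_x  |-> x (x) 1 - 1 (x) x,        e_y |-> y (x) 1 - 1 (x) y,
      e_xy |-> (y (x) 1 - q 1 (x) y) e_x - (q x (x) 1 - 1 (x) x) e_y.
>>
    The last formula is the noncommutative (Fox) differential of the defining
    relation [y x - q x y].

    Exactness ([koszul_resolution]) rests on three facts about right
    multiplication in [E].  Moving the letters of [b] one at a time across the
    tensor sign shows that each [a (x) b] is congruent to [a b (x) 1] modulo the
    images of [e_x] and [e_y] ([mod_dX_dY]).  Right multiplication by
    [c x (x) 1 - 1 (x) x] has a linear left inverse for every scalar [c] ([divX]).
    Finally, modulo [q x (x) 1 - 1 (x) x] every element of [E] becomes a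
    combination of the [a (x) y^j] ([mod_dX]), and such a combination is recovered
    from its product with [y (x) 1 - 1 (x) y] by a linear map that kills the left
    ideal generated by [x (x) 1 - 1 (x) x] ([divY]).

    Tensoring with [C] over [E] gives the complex [C -> C (+) C -> C] with
<<
      d2 m = (m y - q y m, - (q m x - x m)),
      d1 (a, b) = (a x - x a) + (b y - y b).
>>
    On monomials, [m |-> m y - c y m] sends [x^i y^j] to
    [(1 - c q^i) x^i y^(j+1)].  As [q] is not a root of unity, this map is
    bijective for [c = q] ([rYK]), whereas for [c = 1] its kernel is [k[y, y^-1]]
    and the monomials with [i > 0] span its image ([rYK1]); the image of
    [m |-> m x - x m] also lies in positive [x]-degree.  So [d2] is injective, each
    1-cycle is homologous to a unique [(0, b)] with [b] in [k[y, y^-1]], and the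
    cokernel of [d1] is [k[y, y^-1]] ([Tor_koszul]). *)

Set Implicit Arguments.
Unset Strict Implicit.
Unset Printing Implicit Defensive.

Import GRing.Theory.
Local Open Scope ring_scope.

(** * Comparison of projective resolutions *)

Lemma dependent_choice (S : nat -> Type) (R : forall n, S n -> S n.+1 -> Prop)
    (x0 : S 0) : (forall n x, exists y, R n x y) ->
  exists2 f : forall n, S n, f 0 = x0 & forall n, R n (f n) (f n.+1).
Proof.
move=> H; pose step n x := projT1 (cid (H n x)).
exists (nat_rect S x0 step) => // n; exact: projT2 (cid (H n _)).
Qed.

Section Comparison.
Variable A : nzRingType.

(** The lifting property is stated for maps into the image of [f], so that
    exactness can be used without factoring [f] through its image. *)
Definition projective (P : lmodType A) : Prop :=
  forall (X Y : lmodType A) (f : {linear X -> Y}) (u : {linear P -> Y}),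
  (forall p, exists x, f x = u p) ->
  exists v : {linear P -> X}, forall p, f (v p) = u p.

Lemma free_projective (T : choiceType) : projective {malg A[T]}.
Proof.
move=> X Y f u H.
have [w wE] := choice (fun t => H << t >>).
exists (flift w) => p; apply: (malg_eq (f := f \o flift w)) => [||t] /=.
- exact: linearP.
- exact: linearP.
- by rewrite fliftU.
Qed.

Variable N : lmodType A.

Definition resolution (P : nat -> lmodType A)
    (d : forall n, {linear P n.+1 -> P n}) (eps : {linear P 0 -> N}) : Prop :=
  [/\ forall n, projective (P n),
      forall m, exists x, eps x = m,
      forall x, eps x = 0 <-> exists y, x = d 0 y &
      forall n x, d n x = 0 <-> exists y, x = d n.+1 y].

Lemma free_res_resolution : resolution (free_res_diff N) (free_eval N).
Proof.
split; first by move=> n; exact: free_projective.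
- exact: free_eval_surj.
- exact: free_res_exact0.
- exact: free_res_exactS.
Qed.

Section Maps.
Variables (P Q : nat -> lmodType A).
Variables (dP : forall n, {linear P n.+1 -> P n}) (eP : {linear P 0 -> N}).
Variables (dQ : forall n, {linear Q n.+1 -> Q n}) (eQ : {linear Q 0 -> N}).
Hypotheses (resP : resolution dP eP) (resQ : resolution dQ eQ).

Definition chain_map (f : forall n, {linear P n -> Q n}) : Prop :=
  forall n x, dQ n (f n.+1 x) = f n (dP n x).

(** Each [f n] is built from the previous one by projectivity; what has to be
    carried along to continue is only that [f n] sends boundaries to boundaries,
    hence the invariant [ok]. *)
Lemma chain_map_exists : exists2 f : forall n, {linear P n -> Q n},
  chain_map f & forall x, eQ (f 0 x) = eP x.
Proof.
case: resP => prP _ exP0 exP; case: resQ => _ sQ exQ0 exQ.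
pose ok n (f : {linear P n -> Q n}) := forall x, exists y, dQ n y = f (dP n x).
have [f0 f0E] : exists f0 : {linear P 0 -> Q 0}, forall x, eQ (f0 x) = eP x.
  by apply: prP => x; apply: sQ.
have ok0 : ok 0 f0.
  move=> x; have /exQ0[y ->] : eQ (f0 (dP 0 x)) = 0.
    by rewrite f0E; apply/exP0; exists x.
  by exists y.
pose S n := {f : {linear P n -> Q n} | ok n f}.
have [] := @dependent_choice S
  (fun n f g => forall x, dQ n (sval g x) = sval f (dP n x)) (exist _ f0 ok0).
  move=> n [f okf] /=.
  have [g gE] := prP _ _ _ (dQ n) (f \o dP n) okf.
  suff okg : ok n.+1 g by exists (exist _ g okg).
  move=> x; have /exQ[y ->] : dQ n (g (dP n.+1 x)) = 0.
    rewrite gE /=; have -> : dP n (dP n.+1 x) = 0 by apply/exP; exists x.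
    by rewrite linear0.
  by exists y.
move=> F F0 FS; exists (fun n => sval (F n)) => // x.
by rewrite F0.
Qed.

(** Two lifts of the same map differ by such an [f], hence by a homotopy.  The
    invariant [ok] says that [f n.+1 - h n d] takes its values in the boundaries,
    where the next component of the homotopy can be lifted. *)
Lemma chain_homotopy (f : forall n, {linear P n -> Q n}) :
  chain_map f -> (forall x, eQ (f 0 x) = 0) ->
  exists2 h : forall n, {linear P n -> Q n.+1},
    forall x, f 0 x = dQ 0 (h 0 x) &
    forall n x, f n.+1 x = dQ n.+1 (h n.+1 x) + h n (dP n x).
Proof.
move=> cf f0.
case: resP => prP _ exP0 exP; case: resQ => _ sQ exQ0 exQ.
pose ok n (h : {linear P n -> Q n.+1}) :=
  forall x, exists y, dQ n.+1 y = f n.+1 x - h (dP n x).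
have [h0 h0E] : exists h : {linear P 0 -> Q 1}, forall x, dQ 0 (h x) = f 0 x.
  by apply: prP => x; have /exQ0[y ->] := f0 x; exists y.
have ok0 : ok 0 h0.
  move=> x; have /exQ[y ->] : dQ 0 (f 1 x - h0 (dP 0 x)) = 0.
    by rewrite linearB /= h0E cf subrr.
  by exists y.
pose S n := {h : {linear P n -> Q n.+1} | ok n h}.
have [] := @dependent_choice S (fun n h h' =>
  forall x, dQ n.+1 (sval h' x) = f n.+1 x - sval h (dP n x)) (exist _ h0 ok0).
  move=> n [h okh] /=.
  have [g gE] := prP _ _ _ (dQ n.+1) (f n.+1 \- (h \o dP n)) okh.
  suff okg : ok n.+1 g by exists (exist _ g okg).
  move=> x; have /exQ[y ->] : dQ n.+1 (f n.+2 x - g (dP n.+1 x)) = 0.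
    rewrite linearB /= gE /= cf.
    have -> : dP n (dP n.+1 x) = 0 by apply/exP; exists x.
    by rewrite linear0 subr0 subrr.
  by exists y.
move=> F F0 FS; exists (fun n => sval (F n)) => [x|n x].
  by rewrite F0 h0E.
by rewrite FS subrK.
Qed.

End Maps.
End Comparison.

(** * Tor from an arbitrary projective resolution *)

Section TorComputation.
Variables (k : comNzRingType) (A : algType k) (M : lmodType A^c).

Local Notation tens := (tens M).
Local Notation tens_map := (@tens_map k A M _ _).

Lemma tens_eq (N : lmodType A) (W : lmodType k) (f g : {linear tens N -> W}) :
  (forall m n, f (pure _ _ _ m n) = g (pure _ _ _ m n)) -> f =1 g.
Proof. by move=> fg; apply: tensor_eq => //; exact: linearP. Qed.

Lemma pure0r (N : lmodType A) m : pure _ _ _ m 0 = 0 :> tens N.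
Proof. by apply: (@addrI _ (pure _ _ _ m 0)); rewrite addr0 -pureDr addr0. Qed.

Lemma pureBr (N : lmodType A) m (n n' : N) :
  pure _ _ _ m (n - n') = pure _ _ _ m n - pure _ _ _ m n' :> tens N.
Proof. by apply/eqP; rewrite eq_sym subr_eq -pureDr subrK. Qed.

Lemma tens_map_pure (N N' : lmodType A) (g : {linear N -> N'}) m n :
  tens_map g (pure _ _ _ m n) = pure _ _ _ m (g n).
Proof. exact: (tlift_pure (tens_map_balanced M g)). Qed.

Lemma tens_map_comp (N N' N'' : lmodType A) (f : {linear N -> N'})
    (g : {linear N' -> N''}) (z : tens N) :
  tens_map (g \o f) z = tens_map g (tens_map f z).
Proof.
move: z; apply: (tens_eq (g := tens_map g \o tens_map f)) => m n /=.
by rewrite !tens_map_pure.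
Qed.

Lemma tens_mapD (N N' : lmodType A) (f g : {linear N -> N'}) (z : tens N) :
  tens_map (f \+ g) z = tens_map f z + tens_map g z.
Proof.
move: z; apply: (tens_eq (g := tens_map f \+ tens_map g)) => m n /=.
by rewrite !tens_map_pure pureDr.
Qed.

Lemma tens_map_id (N : lmodType A) (f : {linear N -> N}) (z : tens N) :
  f =1 id -> tens_map f z = z.
Proof.
move=> fE; move: z; apply: (tens_eq (g := idfun)) => m n /=.
by rewrite tens_map_pure fE.
Qed.

Lemma eq_tens_map (N N' : lmodType A) (f g : {linear N -> N'}) (z : tens N) :
  f =1 g -> tens_map f z = tens_map g z.
Proof.
by move=> fg; move: z; apply: tens_eq => m n /=; rewrite !tens_map_pure fg.
Qed.

Section Complex.
Variables (P : nat -> lmodType A) (d : forall n, {linear P n.+1 -> P n}).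

Definition tens_diff (n : nat) : {linear tens (P n) -> tens (P n.-1)} :=
  if n is p.+1 return {linear tens (P n) -> tens (P n.-1)}
  then tens_map (d p) else \0.

Definition cycle n (z : tens (P n)) : Prop := tens_diff n z = 0.
Definition boundary n (z : tens (P n)) : Prop := exists u, z = tens_diff n.+1 u.

End Complex.

Lemma tens_diff_map (P Q : nat -> lmodType A)
    (dP : forall n, {linear P n.+1 -> P n}) (dQ : forall n, {linear Q n.+1 -> Q n})
    (f : forall n, {linear P n -> Q n}) n (z : tens (P n)) : chain_map dP dQ f ->
  tens_diff dQ n (tens_map (f n) z) = tens_map (f n.-1) (tens_diff dP n z).
Proof.
move=> cf; case: n z => [|n] z /=; first by rewrite linear0.
by rewrite -!tens_map_comp; apply: eq_tens_map => x; apply: cf.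
Qed.

Lemma tens_homotopy (P Q : nat -> lmodType A)
    (dP : forall n, {linear P n.+1 -> P n}) (dQ : forall n, {linear Q n.+1 -> Q n})
    (f : forall n, {linear P n -> Q n}) (h : forall n, {linear P n -> Q n.+1}) :
  (forall x, f 0 x = dQ 0 (h 0 x)) ->
  (forall n x, f n.+1 x = dQ n.+1 (h n.+1 x) + h n (dP n x)) ->
  forall n z, cycle dP z -> boundary dQ (tens_map (f n) z).
Proof.
move=> h0 hS [|n] z zc.
  exists (tens_map (h 0) z).
  by rewrite /= -tens_map_comp; apply: eq_tens_map.
exists (tens_map (h n.+1) z).
transitivity (tens_map ((dQ n.+1 \o h n.+1) \+ (h n \o dP n)) z).
  exact: eq_tens_map.
by rewrite tens_mapD !tens_map_comp [X in _ + tens_map _ X]zc linear0 addr0.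
Qed.

(** Both composites of the comparison maps between two resolutions of [N] lift the
    identity of [N], so they differ from the identity by a homotopy, and after
    tensoring a homotopy moves cycles by boundaries only. *)
Lemma tens_equivalence (N : lmodType A) (P Q : nat -> lmodType A)
    (dP : forall n, {linear P n.+1 -> P n}) (eP : {linear P 0 -> N})
    (dQ : forall n, {linear Q n.+1 -> Q n}) (eQ : {linear Q 0 -> N}) :
  resolution dP eP -> resolution dQ eQ ->
  exists f : forall n, {linear P n -> Q n},
  exists g : forall n, {linear Q n -> P n},
  [/\ chain_map dP dQ f, chain_map dQ dP g,
     forall n z,
       cycle dP z -> boundary dP (tens_map (g n) (tens_map (f n) z) - z) &
     forall n z,
       cycle dQ z -> boundary dQ (tens_map (f n) (tens_map (g n) z) - z)].
Proof.
move=> rP rQ.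
have [f cf f0] := chain_map_exists rP rQ.
have [g cg g0] := chain_map_exists rQ rP.
have main (P' Q' : nat -> lmodType A)
    (dP' : forall n, {linear P' n.+1 -> P' n}) (eP' : {linear P' 0 -> N})
    (dQ' : forall n, {linear Q' n.+1 -> Q' n}) (eQ' : {linear Q' 0 -> N})
    (f' : forall n, {linear P' n -> Q' n}) (g' : forall n, {linear Q' n -> P' n}) :
    resolution dP' eP' -> chain_map dP' dQ' f' -> chain_map dQ' dP' g' ->
    (forall x, eQ' (f' 0 x) = eP' x) -> (forall x, eP' (g' 0 x) = eQ' x) ->
    forall n z,
      cycle dP' z -> boundary dP' (tens_map (g' n) (tens_map (f' n) z) - z).
  move=> rP' cf' cg' f'0 g'0 n z zc.
  pose e n : {linear P' n -> P' n} := (g' n \o f' n) \- idfun.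
  have ce : chain_map dP' dP' e.
    by move=> p x; rewrite /e /= linearB /= cg' cf'.
  have e0 x : eP' (e 0 x) = 0 by rewrite /e /= linearB /= g'0 f'0 subrr.
  have [h h0 hS] := chain_homotopy rP' rP' ce e0.
  have := tens_homotopy h0 hS zc; congr boundary.
  rewrite -tens_map_comp; apply/eqP; rewrite eq_sym subr_eq; apply/eqP.
  rewrite -[X in _ + X](@tens_map_id _ idfun z) // -tens_mapD.
  by apply: eq_tens_map => x /=; rewrite subrK.
exists f, g; split=> //.
- exact: (main _ _ dP eP dQ eQ).
- exact: (main _ _ dQ eQ dP eP).
Qed.

Lemma boundary_cycle (N : lmodType A) (P : nat -> lmodType A)
    (d : forall n, {linear P n.+1 -> P n}) (eps : {linear P 0 -> N}) n z :
  resolution d eps -> boundary d z -> @cycle P d n z.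
Proof.
case=> _ _ _ ex [u ->]; case: n z u => [//|n] z u.
rewrite /cycle /= -tens_map_comp (@eq_tens_map _ _ _ \0); last first.
  by move=> x /=; apply/ex; exists x.
by move: u; apply: (tens_eq (g := \0)) => m x /=; rewrite tens_map_pure pure0r.
Qed.

(** As [phi] lives on the whole of [V], and only its values on cycles are
    constrained, the hypotheses are easy to transport along chain maps. *)
Lemma homology_iso (U V V' W : lmodType k) (f : {linear U -> V})
    (g : {linear V -> V'}) (phi : {linear V -> W}) :
  (forall v, g v = 0 -> phi v = 0 <-> exists u, v = f u) ->
  (forall w, exists2 v, g v = 0 & phi v = w) ->
  lin_iso (homology f g) W.
Proof.
move=> phi0 phis.
pose S (z : ker g) := exists u, val z = f u.
pose psi : {linear ker g -> W} := phi \o val.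
have kz (z : ker g) : g (val z) = 0 by apply/eqP; exact: valP z.
have S0 z : S z -> psi z = 0 by move/(phi0 _ (kz z)).
have lE z : qlift psi (qpi S z) = psi z by apply: qliftE => //; exact: linearP.
have ll : linear (qlift psi : homology f g -> W).
  by move=> a; elim/qind=> u; elim/qind=> v; rewrite -linearP !lE linearP.
pose F := HB.pack_for {linear homology f g -> W} (qlift psi : homology f g -> W)
  (GRing.isLinear.Build k (homology f g) W _ (qlift psi : homology f g -> W) ll).
have injF x y : F x = F y -> x = y.
  elim/qind: x => x; elim/qind: y => y; rewrite /F /= !lE => Exy.
  have Exy0 : psi (x - y) = 0 by rewrite linearB Exy subrr.
  apply/qpiP; apply: span_gen.
  exact: (proj1 (phi0 (val (x - y)) (kz (x - y))) Exy0).
have surF w : exists x, F x = w.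
  have [v gv <-] := phis w.
  have Kv : v \in ker_pred g by rewrite inE gv.
  by exists (qpi S (Ker Kv)); rewrite /F /= lE.
have [G GE] := choice surF.
by exists F; exists G => // x; apply: injF.
Qed.

(** It suffices to test [phi] on the cycles of one convenient resolution: composed
    with the comparison map, it satisfies the same criterion on the canonical
    one. *)
Lemma Tor_iso (N : lmodType A) (P : nat -> lmodType A)
    (d : forall n, {linear P n.+1 -> P n}) (eps : {linear P 0 -> N})
    (n : nat) (W : lmodType k) (phi : {linear tens (P n) -> W}) :
  resolution d eps ->
  (forall z, cycle d z -> phi z = 0 <-> boundary d z) ->
  (forall w, exists2 z, cycle d z & phi z = w) ->
  lin_iso (Tor M N n) W.
Proof.
move=> rP phi0 phis.
have [f [g [cf cg gf fg]]] := tens_equivalence rP (free_res_resolution N).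
have -> : Tor M N n =
    homology (tens_diff (free_res_diff N) n.+1) (tens_diff (free_res_diff N) n).
  by case: n phi phi0 phis.
apply: (homology_iso (phi := phi \o tens_map (g n))) => [v vc /=|w].
  have gvc : cycle d (tens_map (g n) v).
    by rewrite /cycle (tens_diff_map _ cg) vc linear0.
  split=> [/(phi0 _ gvc)[u Eu]|[u ->]].
    have [u' Eu'] := fg n v vc.
    exists (tens_map (f n.+1) u - u').
    rewrite linearB -Eu' (tens_diff_map _ cf) /= -Eu.
    by rewrite opprB addrC subrK.
  have gb : boundary d (tens_map (g n) (tens_diff (free_res_diff N) n.+1 u)).
    by exists (tens_map (g n.+1) u); rewrite (tens_diff_map _ cg).
  by apply/phi0 => //; apply: boundary_cycle rP gb.
have [z zc <-] := phis w.
exists (tens_map (f n) z); first by rewrite (tens_diff_map _ cf) zc linear0.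
apply/eqP; rewrite -subr_eq0 /= -linearB; apply/eqP.
by apply/phi0; [apply: boundary_cycle rP _|]; exact: gf.
Qed.

Lemma Tor_eq0 (N : lmodType A) (P : nat -> lmodType A)
    (d : forall n, {linear P n.+1 -> P n}) (eps : {linear P 0 -> N}) (n : nat) :
  resolution d eps -> (forall z : tens (P n), cycle d z -> boundary d z) ->
  forall z : Tor M N n, z = 0.
Proof.
move=> rP exP z.
have [z' /exP|w|f /bij_inj inj_f] := @Tor_iso N P d eps n 'rV[k]_0 \0 rP.
- by [].
- by exists 0; [rewrite /cycle linear0 | rewrite [w]thinmx0].
by apply: inj_f; rewrite [f z]thinmx0 linear0.
Qed.

End TorComputation.

(** * Monomials of the quantum cylinder *)

Section QuantumCylinder.
Variables (k : fieldType) (q : k) (q0 : q != 0).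

Local Notation C := (qcyl q0).

Definition mon (i : nat) (j : int) : C := xy k (i, j).

Local Notation x := (mon 1 0).
Local Notation y := (mon 0 1).
Local Notation yV := (mon 0 (-1)).

Lemma monM i j i' j' :
  mon i j * mon i' j' = q ^ (j * i'%:Z) *: mon (i + i') (j + j').
Proof. exact: qmulE. Qed.

Lemma monE i j : mon i j = << (i, j) >>.
Proof. by rewrite /mon unlock. Qed.

Lemma mon1 : mon 0 0 = 1. Proof. by []. Qed.

Lemma xMmon i j : x * mon i j = mon i.+1 j.
Proof. by rewrite monM mul0r expr0z scale1r add0r. Qed.

Lemma monMx i j : mon i j * x = q ^ j *: mon i.+1 j.
Proof. by rewrite monM mulr1 addr0 addn1. Qed.

Lemma monMy i j : mon i j * y = mon i (j + 1).
Proof. by rewrite monM mulr0 expr0z scale1r addn0. Qed.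

Lemma monMyV i j : mon i j * yV = mon i (j - 1).
Proof. by rewrite monM mulr0 expr0z scale1r addn0. Qed.

Lemma yMmon i j : y * mon i j = q ^+ i *: mon i (1 + j).
Proof. by rewrite monM mul1r. Qed.

Lemma yVMmon i j : yV * mon i j = q ^- i *: mon i (j - 1).
Proof. by rewrite monM mulN1r -exprnN addrC. Qed.

Lemma yyV : y * yV = 1. Proof. by rewrite monMyV. Qed.
Lemma yVy : yV * y = 1. Proof. by rewrite monMy addNr. Qed.

Lemma yx : y * x = q *: (x * y).
Proof. by rewrite yMmon xMmon expr1. Qed.

Lemma mon_ind (P : C -> Prop) :
  submodule P -> P 1 -> (forall c, P c -> P (x * c)) ->
  (forall c, P c -> P (y * c)) -> (forall c, P c -> P (yV * c)) ->
  forall c, P c.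
Proof.
move=> subP P1 Px Py PyV; apply: malg_ind => // -[i j]; rewrite -monE.
elim: i => [|i IH]; last by rewrite -xMmon; apply: Px.
elim/int_ind: j => [|n IH|n IH] //.
- by have := Py _ IH; rewrite yMmon expr0 scale1r -PoszD add1n.
- by have := PyV _ IH; rewrite yVMmon expr0 invr1 scale1r -opprD -PoszD addn1.
Qed.

Lemma mon_eq (W : lmodType k) (f g : {linear C -> W}) :
  (forall i j, f (mon i j) = g (mon i j)) -> f =1 g.
Proof. by move=> fg; apply: xy_eq => //; exact: linearP. Qed.

(** * The operators of the Koszul complex on the quantum cylinder *)

(** The right actions on [C] of the elements [dX c] and [dY c] of the enveloping
    algebra defined below; [a (x) b] acts on the right by [m |-> b m a]. *)
Definition rX c (m : C) : C := c *: (m * x) - x * m.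
Definition rY c (m : C) : C := m * y - c *: (y * m).

Lemma rX_linear c : linear (rX c).
Proof.
move=> a m m'; rewrite /rX mulrDl mulrDr -scalerAl -scalerAr scalerDr scalerBr.
by rewrite !scalerA [c * a]mulrC opprD addrACA.
Qed.
HB.instance Definition _ c := GRing.isLinear.Build k C C _ (rX c) (rX_linear c).

Lemma rY_linear c : linear (rY c).
Proof.
move=> a m m'; rewrite /rY mulrDl mulrDr -scalerAl -scalerAr scalerDr scalerBr.
by rewrite !scalerA [c * a]mulrC opprD addrACA.
Qed.
HB.instance Definition _ c := GRing.isLinear.Build k C C _ (rY c) (rY_linear c).

Lemma rX_mon c i j : rX c (mon i j) = (c * q ^ j - 1) *: mon i.+1 j.
Proof. by rewrite /rX monMx xMmon scalerA scalerBl scale1r. Qed.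

Lemma rY_mon c i j : rY c (mon i j) = (1 - c * q ^+ i) *: mon i (j + 1).
Proof. by rewrite /rY monMy yMmon scalerA scalerBl scale1r [1 + j]addrC. Qed.

(** A pseudo-inverse of [rY c]: where [1 - c * q ^+ i] vanishes, so does its
    inverse. *)
Definition rYinv c : C -> C :=
  flift (fun t => (1 - c * q ^+ t.1)^-1 *: mon t.1 (t.2 - 1)).
HB.instance Definition _ c := GRing.Linear.on (rYinv c).

Lemma rYinv_mon c i j :
  rYinv c (mon i j) = (1 - c * q ^+ i)^-1 *: mon i (j - 1).
Proof. by rewrite /rYinv [mon i j]monE fliftU. Qed.

(** The part of degree 0 in [x]. *)
Definition rho : C -> laurent k :=
  flift (fun t => if t.1 == 0 then << t.2 >> else 0).
HB.instance Definition _ := GRing.Linear.on rho.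

Lemma rho_mon i j : rho (mon i j) = if i == 0 then << j >> else 0.
Proof. by rewrite /rho monE fliftU. Qed.

Definition sec : laurent k -> C := flift (mon 0).
HB.instance Definition _ := GRing.Linear.on sec.

Lemma rho_sec : cancel sec rho.
Proof.
apply: malg_eq => [a u v||j] //; first by rewrite !linearP.
by rewrite /sec fliftU rho_mon.
Qed.

Lemma rY_sec w : rY 1 (sec w) = 0.
Proof.
move: w; apply: (malg_eq (g := fun=> 0)) => [a u v|a u v|j].
- by rewrite !linearP.
- by rewrite scaler0 addr0.
- by rewrite /sec fliftU rY_mon expr0 mulr1 subrr scale0r.
Qed.

Lemma rho_rX c m : rho (rX c m) = 0.
Proof.
move: m; apply: (@mon_eq _ (rho \o rX c) \0) => i j /=.
by rewrite rX_mon linearZ /= rho_mon scaler0.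
Qed.

Lemma rho_rY m : rho (rY 1 m) = 0.
Proof.
move: m; apply: (@mon_eq _ (rho \o rY 1) \0) => i j /=.
rewrite rY_mon linearZ /= rho_mon; case: eqP => [->|_]; last by rewrite scaler0.
by rewrite expr0 mulr1 subrr scale0r.
Qed.

Lemma rYinvC c m : rY c (rYinv c m) = rYinv c (rY c m).
Proof.
move: m; apply: (@mon_eq _ (rY c \o rYinv c) (rYinv c \o rY c)) => i j /=.
rewrite rYinv_mon rY_mon !linearZ /= rYinv_mon rY_mon !scalerA mulrC.
by rewrite subrK addrK.
Qed.

(** This is [d1 \o d2 = 0] for the complex [C -> C (+) C -> C]. *)
Lemma rX_rY m : rX 1 (rY q m) = rY 1 (rX q m).
Proof.
move: m; apply: (@mon_eq _ (rX 1 \o rY q) (rY 1 \o rX q)) => i j /=.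
rewrite rX_mon rY_mon !linearZ /= rX_mon rY_mon !scalerA !mul1r mulrC.
by rewrite -exprS expfzDr // expr1z [q ^ j * q]mulrC.
Qed.

Section NotRootOfUnity.
Hypothesis hq : forall m : nat, (0 < m)%N -> q ^+ m != 1.

(** Here [1 - q * q ^+ i] never vanishes, as the exponent of [q] is positive. *)
Lemma rYK m : rYinv q (rY q m) = m.
Proof.
move: m; apply: (@mon_eq _ (rYinv q \o rY q) idfun) => i j /=.
rewrite rY_mon linearZ /= rYinv_mon scalerA addrK -exprS mulfV ?scale1r //.
by rewrite subr_eq0 eq_sym hq.
Qed.

Lemma rYK1 m : rYinv 1 (rY 1 m) = m - sec (rho m).
Proof.
move: m.
apply: (@mon_eq _ (rYinv 1 \o rY 1) (idfun \- (sec \o rho))) => i j /=.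
rewrite rY_mon linearZ /= rYinv_mon scalerA addrK rho_mon mul1r.
case: eqP => [->|/eqP i0].
  by rewrite expr0 subrr mul0r scale0r /sec fliftU subrr.
rewrite linear0 subr0 mulfV ?scale1r //.
by rewrite subr_eq0 eq_sym hq // lt0n.
Qed.

End NotRootOfUnity.

(** * Right multiplication in the enveloping algebra *)

(** The enveloping algebra enters only through the properties of the products
    [ep a b], standing for [a (x) b], that are listed here; the last one is the
    universal property of the tensor product. *)
Section Enveloping.
Variables (E : algType k) (ep : C -> C -> E).
Hypothesis ep_linl : forall b, linear (ep^~ b).
Hypothesis ep_linr : forall a, linear (ep a).
Hypothesis epM : forall a b a' b', ep a b * ep a' b' = ep (a * a') (b' * b).
Hypothesis ep_ind : forall P : E -> Prop,
  submodule P -> (forall a b, P (ep a b)) -> forall e, P e.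
Hypothesis ep_lift : forall f : C -> C -> E,
  (forall b, linear (f^~ b)) -> (forall a, linear (f a)) ->
  exists F : {linear E -> E}, forall a b, F (ep a b) = f a b.

Lemma epZl c a b : ep (c *: a) b = c *: ep a b.
Proof.
by rewrite -[c *: a]addr0 ep_linl (linear_prop0 (ep_linl b)) addr0.
Qed.

Lemma epZr c a b : ep a (c *: b) = c *: ep a b.
Proof.
by rewrite -[c *: b]addr0 ep_linr (linear_prop0 (ep_linr a)) addr0.
Qed.

Lemma ep_eq (f g : E -> E) : linear f -> linear g ->
  (forall a i j, f (ep a (mon i j)) = g (ep a (mon i j))) -> f =1 g.
Proof.
move=> lf lg fg; apply: ep_ind.
  split=> [|c u v fu fv]; first by rewrite !linear_prop0.
  by rewrite lf lg fu fv.
move=> a; apply: malg_eq.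
- by move=> c b b'; rewrite ep_linr lf.
- by move=> c b b'; rewrite ep_linr lg.
by move=> [i j]; rewrite -monE fg.
Qed.

Lemma ep_lift_mon (S : nat -> int -> {linear C -> E}) :
  exists F : {linear E -> E}, forall a i j, F (ep a (mon i j)) = S i j a.
Proof.
have [b|a|F FE] := ep_lift (f := fun a => flift (fun t => S t.1 t.2 a)).
- move=> c a a'; move: b; apply: malg_eq.
  + exact: flift_linear.
  + by apply: linear_comb; exact: flift_linear.
  by move=> t; rewrite !fliftU linearP.
- exact: flift_linear.
by exists F => a i j; rewrite FE monE fliftU.
Qed.

Definition rmul (b a : C) : C := a * b.
Lemma rmul_linear b : linear (rmul b).
Proof. by move=> c a a'; rewrite /rmul mulrDl scalerAl. Qed.
HB.instance Definition _ b :=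
  GRing.isLinear.Build k C C _ (rmul b) (rmul_linear b).

Definition epl (b a : C) : E := ep a b.
HB.instance Definition _ b :=
  GRing.isLinear.Build k C E _ (epl b) (ep_linl b).

(** The parameter [c] is [1] for the differential of degree 1 of the Koszul
    resolution and [q] for the differential of degree 2. *)
Definition dX (c : k) : E := c *: ep x 1 - ep 1 x.
Definition dY (c : k) : E := ep y 1 - c *: ep 1 y.

Lemma ep_dX a b c :
  ep a b * dX c = c *: ep (a * x) b - ep a (x * b).
Proof. by rewrite mulrBr -scalerAr !epM mul1r mulr1. Qed.

Lemma ep_dY a b c :
  ep a b * dY c = ep (a * y) b - c *: ep a (y * b).
Proof. by rewrite mulrBr -scalerAr !epM mul1r mulr1. Qed.

(** This identity is [d \o d = 0] for the Koszul resolution; it holds because of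
    [y x = q x y]. *)
Lemma dYX : dY q * dX 1 = dX q * dY 1.
Proof.
rewrite [in LHS]/dY [in RHS]/dX [LHS]mulrBl [RHS]mulrBl.
rewrite -[X in _ - X = _]scalerAl -[X in _ = X - _]scalerAl.
rewrite 2!ep_dX 2!ep_dY !scale1r 2!mul1r 2!mulr1.
have -> : ep (y * x) 1 = q *: ep (x * y) 1 by rewrite yx epZl.
have -> : ep 1 (y * x) = q *: ep 1 (x * y) by rewrite yx epZr.
have swap (V : lmodType k) (a b c d : V) :
    q *: a - c - q *: (b - d) = q *: (a - b) - (c - q *: d).
  rewrite 2!scalerBr !opprB [q *: d - _]addrC addrACA.
  by rewrite [- c + _]addrC.
exact: swap.
Qed.

(** The value at [a (x) x^i y^j] of a left inverse of right multiplication by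
    [dX c].  The recursion is forced by [ep_dX], and the value at [i = 0] is
    free. *)
Fixpoint divX_coef (c : k) (i : nat) (j : int) : {linear C -> E} :=
  if i is i'.+1
  then (c \*: (divX_coef c i' j \o rmul x)) \- epl (mon i' j)
  else \0.

Lemma divX c : exists F : {linear E -> E}, forall e, F (e * dX c) = e.
Proof.
have [F FE] := ep_lift_mon (divX_coef c); exists F.
apply: ep_eq => [||a i j] //.
  by move=> b e e'; rewrite mulrDl -scalerAl linearP.
by rewrite ep_dX xMmon linearB linearZ /= !FE /= opprB addrC subrK.
Qed.

Lemma dX_inj c e : e * dX c = 0 -> e = 0.
Proof. by have [F FE] := divX c => e0; rewrite -(FE e) e0 linear0. Qed.

(** The recursion [divY_coefE] has a unique solution that vanishes at [j = 0]; it is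
    solved upwards for [j >= 0], and downwards for [j < 0] by means of [y^-1]. *)
Fixpoint divY_pos (n : nat) : {linear C -> E} :=
  if n is n'.+1
  then (divY_pos n' \o rmul y) \- epl (mon 0 n')
  else \0.

Fixpoint divY_neg (n : nat) : {linear C -> E} :=
  if n is n'.+1
  then (divY_neg n' \+ epl (mon 0 (Negz n))) \o rmul yV
  else epl (mon 0 (-1)) \o rmul yV.

Definition divY_coef (j : int) : {linear C -> E} :=
  match j with Posz n => divY_pos n | Negz n => divY_neg n end.

Lemma divY_coefE a j :
  divY_coef j (a * y) - divY_coef (j + 1) a = ep a (mon 0 j).
Proof.
case: j => [n|[|n]].
- by rewrite -PoszD addn1 /= opprB addrC subrK.
- by rewrite /= /rmul -mulrA yyV mulr1 subr0.
- have -> : Negz n.+1 + 1 = Negz n by rewrite !NegzE -addn1 PoszD opprD subrK.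
  have -> : divY_coef (Negz n.+1) (a * y) =
    divY_neg n (a * y * yV) + ep (a * y * yV) (mon 0 (Negz n.+1)) by [].
  by rewrite -mulrA yyV mulr1 addrAC subrr add0r.
Qed.

(** Before the division by [dY 1], an element [a (x) x^i y^j] is replaced with
    [a x^i (x) y^j]; this kills the left multiples of [dX 1]. *)
Lemma divY : exists F : {linear E -> E},
  (forall e, F (e * dX 1) = 0) /\
  (forall a j, F (ep a (mon 0 j) * dY 1) = ep a (mon 0 j)).
Proof.
have [F FE] := ep_lift_mon (fun i j => divY_coef j \o rmul (mon i 0)).
exists F; split; last first.
  move=> a j; rewrite ep_dY yMmon expr0 !scale1r linearB /= !FE /= /rmul.
  by rewrite !mon1 !mulr1 [1 + j]addrC divY_coefE.
apply: (ep_eq (g := fun=> 0)) => [||a i j].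
- by move=> b e e'; rewrite mulrDl -scalerAl linearP.
- by move=> b e e'; rewrite scaler0 addr0.
by rewrite ep_dX xMmon scale1r linearB /= !FE /= /rmul -mulrA xMmon subrr.
Qed.

(** Modulo [dX q] the powers of [x] can be moved to the left factor, at the cost
    of powers of [q], so the remainder [r] is a combination of the [a (x) y^j].
    Only the equation [F (r * dY 1) = r], which holds for all of these, is kept. *)
Lemma mod_dX (F : {linear E -> E}) :
    (forall a j, F (ep a (mon 0 j) * dY 1) = ep a (mon 0 j)) ->
  forall e, exists g r, e = g * dX q + r /\ F (r * dY 1) = r.
Proof.
move=> FY; apply: ep_ind.
  split; first by exists 0, 0; rewrite !mul0r addr0 linear0.
  move=> c e e' [g [r [-> rE]]] [g' [r' [-> rE']]].
  exists (c *: g + g'), (c *: r + r'); split.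
    by rewrite mulrDl scalerDr -scalerAl addrACA.
  by rewrite mulrDl -scalerAl linearP /= rE rE'.
move=> a b; move: b a; apply: malg_ind.
  split=> [a|c b b' H H' a].
    by exists 0, 0; rewrite !mul0r addr0 linear0 (linear_prop0 (ep_linr a)).
  rewrite ep_linr; have [g [r [-> rE]]] := H a; have [g' [r' [-> rE']]] := H' a.
  exists (c *: g + g'), (c *: r + r'); split.
    by rewrite mulrDl scalerDr -scalerAl addrACA.
  by rewrite mulrDl -scalerAl linearP /= rE rE'.
case=> i j; rewrite -monE; elim: i => [|i IH] a.
  by exists 0, (ep a (mon 0 j)); rewrite mul0r add0r FY.
have [g [r [E1 rE]]] := IH (a * x).
exists (q *: g - ep a (mon i j)), (q *: r); split; last first.
  by rewrite -scalerAl linearZ /= rE.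
rewrite mulrBl -scalerAl addrAC -scalerDr -E1 ep_dX xMmon.
by rewrite opprB addrC subrK.
Qed.

(** Exactness of the Koszul resolution in degree 1.  Once [b] is reduced modulo
    [dX q], the map [F], which kills the left multiples of [dX 1], shows that the
    remainder vanishes; then [a] is determined because [dX 1] can be cancelled on the
    right. *)
Lemma dX_dY_exact a b : a * dX 1 + b * dY 1 = 0 ->
  exists g, a = g * dY q /\ b = - (g * dX q).
Proof.
have [F [FX FY]] := divY.
have [g [r [-> rE]]] := mod_dX FY b.
rewrite mulrDl -mulrA -dYX mulrA addrA -mulrDl.
move=> /[dup] /(congr1 F); rewrite linearD linear0 /= FX add0r rE => ->.
rewrite mul0r !addr0 => /dX_inj/eqP; rewrite addr_eq0 => /eqP ->.
by exists (- g); rewrite !mulNr opprK.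
Qed.

(** For [e = a (x) b] one takes [c = a b]: the letters of [b] are moved to the left
    factor one by one. *)
Lemma mod_dX_dY e : exists c a b, e = ep c 1 + (a * dX 1 + b * dY 1).
Proof.
pose Q e := exists a b, e = a * dX 1 + b * dY 1.
have Qs : submodule Q.
  split; first by exists 0, 0; rewrite !mul0r addr0.
  move=> c _ _ [a [b ->]] [a' [b' ->]]; exists (c *: a + a'), (c *: b + b').
  by rewrite scalerDr !mulrDl -!scalerAl addrACA.
have QX f : Q (f * dX 1) by exists f, 0; rewrite mul0r addr0.
have QY f : Q (f * dY 1) by exists 0, f; rewrite mul0r add0r.
have QD f g : Q f -> Q g -> Q (f + g).
  by move=> Qf Qg; rewrite -[f]scale1r; apply: Qs.2.
have QN f : Q f -> Q (- f).
  by move=> Qf; rewrite -[- f]addr0 -scaleN1r; apply: Qs.2 => //; case: Qs.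
suff [u [a [b H]]] : exists u, Q (e - ep u 1).
  by exists u, a, b; rewrite -H addrC subrK.
move: e; apply: ep_ind.
  split; first by exists 0; rewrite (linear_prop0 (ep_linl 1)) subrr; case: Qs.
  move=> c e f [u Qe] [v Qf]; exists (c *: u + v).
  by rewrite ep_linl opprD addrACA -scalerBr; apply: Qs.2.
move=> a b; exists (a * b); move: b a; apply: mon_ind.
- split=> [a|c b b' Qb Qb' a].
    rewrite mulr0 (linear_prop0 (ep_linr a)) (linear_prop0 (ep_linl 1)) subrr.
    by case: Qs.
  rewrite mulrDr -scalerAr ep_linr ep_linl opprD addrACA -scalerBr.
  exact: Qs.2.
- by move=> a; rewrite mulr1 subrr; case: Qs.
- move=> b Qb a; rewrite mulrA.
  have -> : ep a (x * b) = ep (a * x) b - ep a b * dX 1.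
    by rewrite ep_dX scale1r opprB addrC subrK.
  by rewrite addrAC; apply: QD => //; apply: QN.
- move=> b Qb a; rewrite mulrA.
  have -> : ep a (y * b) = ep (a * y) b - ep a b * dY 1.
    by rewrite ep_dY scale1r opprB addrC subrK.
  by rewrite addrAC; apply: QD => //; apply: QN.
- move=> b Qb a; rewrite mulrA.
  have -> : ep a (yV * b) = ep (a * yV) b + ep (a * yV) (yV * b) * dY 1.
    rewrite ep_dY scale1r -mulrA yVy mulr1 mulrA yyV mul1r.
    by rewrite addrC subrK.
  by rewrite addrAC; apply: QD.
Qed.

(** * The Koszul resolution *)

(** Basis of the resolution: [tt] in degree 0, [e_x = true] and [e_y = false] in
    degree 1, and [tt] for [e_xy] in degree 2. *)
Definition kidx (n : nat) : choiceType :=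
  match n with
  | 0 => unit
  | 1 => bool
  | 2 => unit
  | _ => void
  end.

Definition koszul (n : nat) : lmodType E := {malg E[kidx n]}.

Definition koszul_gen (n : nat) : kidx n.+1 -> koszul n :=
  match n return kidx n.+1 -> koszul n with
  | 0 => fun t => (if t then dX 1 else dY 1) *: << tt >>
  | 1 => fun=> dY q *: << true >> - dX q *: << false >>
  | _ => fun=> 0
  end.

Definition koszul_diff (n : nat) : {linear koszul n.+1 -> koszul n} :=
  flift (@koszul_gen n).

Lemma malg_unit (p : {malg E[unit]}) : p = p@_tt *: << tt >>.
Proof. by apply/malgP=> -[]; rewrite mcoeffZ mcoeffUU mulr1. Qed.

Lemma malg_bool (p : {malg E[bool]}) :
  p = p@_true *: << true >> + p@_false *: << false >>.
Proof.
apply/malgP=> -[]; rewrite mcoeffD !mcoeffZ !mcoeffU mulr1 mulr0.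
- by rewrite addr0.
- by rewrite add0r.
Qed.

Section Resolution.
Variables (N : lmodType E) (n0 : N).
(** These hold for [N = C] and [n0 = 1], where [a (x) b] acts by
    [m |-> a m b]. *)
Hypothesis ep_n0 : forall a b, ep a b *: n0 = ep (a * b) 1 *: n0.
Hypothesis n0_gen : forall n, exists c, n = ep c 1 *: n0.
Hypothesis n0_free : forall c, ep c 1 *: n0 = 0 -> c = 0.

Definition koszul_eps : {linear koszul 0 -> N} := flift (fun _ : unit => n0).

Lemma koszul_resolution : resolution koszul_diff koszul_eps.
Proof.
have dX_n0 : dX 1 *: n0 = 0.
  by rewrite /dX scale1r scalerBl [ep 1 x *: _]ep_n0 mul1r subrr.
have dY_n0 : dY 1 *: n0 = 0.
  by rewrite /dY scale1r scalerBl [ep 1 y *: _]ep_n0 mul1r subrr.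
have d0E a b : koszul_diff 0 (a *: << true >> + b *: << false >>)
    = (a * dX 1 + b * dY 1) *: << tt >>.
  by rewrite linearD !linearZ /= !fliftU /= !scalerA -scalerDl.
have d1E c : koszul_diff 1 (c *: << tt >>)
    = (c * dY q) *: << true >> + (- (c * dX q)) *: << false >>.
  by rewrite linearZ /= fliftU /= scalerBr !scalerA scaleNr.
split.
- by move=> n; exact: free_projective.
- move=> n; have [c ->] := n0_gen n; exists (ep c 1 *: << tt >>).
  by rewrite linearZ /= fliftU.
- move=> p; split=> [|[r ->]]; last first.
    rewrite (malg_bool r) d0E linearZ /= fliftU scalerDl -!scalerA dX_n0 dY_n0.
    by rewrite !scaler0 addr0.
  rewrite (malg_unit p) linearZ /= fliftU.
  have [c [a [b ->]]] := mod_dX_dY p@_tt => c0.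
  exists (a *: << true >> + b *: << false >>); rewrite d0E.
  suff -> : c = 0 by rewrite (linear_prop0 (ep_linl 1)) add0r.
  apply: n0_free; rewrite -c0 !scalerDl -!scalerA dX_n0 dY_n0.
  by rewrite !scaler0 !addr0.
case=> [|[|n]] p.
- split=> [|[r ->]]; last first.
    rewrite (malg_unit r) d1E d0E -mulrA dYX mulNr -mulrA subrr.
    by rewrite scale0r.
  rewrite (malg_bool p) d0E => /(congr1 (mcoeff tt)).
  rewrite mcoeffZ mcoeffUU mulr1 mcoeff0 => /dX_dY_exact[g [-> ->]].
  by exists (g *: << tt >>); rewrite d1E.
- split=> [|[r ->]]; last first.
    by rewrite (_ : r = 0) ?linear0 //; apply/malgP=> -[].
  rewrite (malg_unit p) d1E => /(congr1 (mcoeff false)).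
  rewrite mcoeffD !mcoeffZ !mcoeffU mulr0 mulr1 mcoeff0 add0r => /eqP.
  rewrite oppr_eq0 => /eqP/dX_inj ->.
  by exists 0; rewrite scale0r linear0.
- split=> [_|[r ->]]; last first.
    by rewrite (_ : r = 0) ?linear0 //; apply/malgP=> -[].
  by exists 0; rewrite linear0; apply/malgP=> -[].
Qed.

End Resolution.

(** * Tensoring with the bimodule *)

(** The right [E]-module [M] is identified by [kappa] with [C], where [a (x) b] acts
    on the right by [m |-> b m a].  The tensor product of [M] with the free module
    on a finite [T] then is [C^T], by the coordinates [tcoef t], with inverse the
    sum of the [tgen t]. *)
Section Coefficients.
Variables (M : lmodType E^c) (kappa : M -> C) (iota : C -> M).
Hypotheses (kappaK : cancel kappa iota) (iotaK : cancel iota kappa).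
Hypothesis kappaD : {morph kappa : m m' / m + m'}.
Hypothesis kappa_ep : forall a b m,
  kappa ((ep a b : E^c) *: m) = b * kappa m * a.
Hypothesis ep1 : ep 1 1 = 1.

Local Notation tens := (tens M).

Lemma kappaZ c m : kappa ((c%:A : E^c) *: m) = c *: kappa m.
Proof.
rewrite -[c%:A](_ : ep (c *: 1) 1 = _); last by rewrite epZl ep1.
by rewrite kappa_ep mul1r -scalerAr mulr1.
Qed.

Definition tcoef (T : choiceType) (t : T) : tens {malg E[T]} -> C :=
  tlift (fun m (p : {malg E[T]}) => kappa ((p@_t : E^c) *: m)).

Lemma tcoef_balanced (T : choiceType) (t : T) :
  @balanced k M {malg E[T]} E (fun c m => (c%:A : E^c) *: m)
    (fun m e => (e : E^c) *: m) (fun e p => e *: p) C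
    (fun m (p : {malg E[T]}) => kappa ((p@_t : E^c) *: m)).
Proof.
split=> [m m' p|m p p'|c m p|m e p].
- by rewrite scalerDr kappaD.
- by rewrite mcoeffD scalerDl kappaD.
- rewrite -kappaZ !scalerA; congr (kappa (_ *: _)).
  by rewrite -[LHS]/(c%:A * p@_t) -[RHS]/(p@_t * c%:A) mulr_algl mulr_algr.
- by rewrite scalerA mcoeffZ.
Qed.

HB.instance Definition _ (T : choiceType) (t : T) :=
  GRing.isLinear.Build k (tens {malg E[T]}) C _ (tcoef t)
    (tlift_linear (tcoef_balanced t)).

Lemma tcoefE (T : choiceType) (t : T) m p :
  tcoef t (pure _ _ _ m p) = kappa ((p@_t : E^c) *: m).
Proof. exact: (tlift_pure (tcoef_balanced t)). Qed.

Definition tgen (T : choiceType) (t : T) (c : C) : tens {malg E[T]} :=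
  pure _ _ _ (iota c) << t >>.

Lemma tgen_linear (T : choiceType) (t : T) : linear (tgen t).
Proof.
move=> c a b; rewrite /tgen.
have -> : iota (c *: a + b) = (c%:A : E^c) *: iota a + iota b.
  by apply: (can_inj kappaK); rewrite iotaK kappaD kappaZ !iotaK.
by rewrite pureDl pureZ.
Qed.

HB.instance Definition _ (T : choiceType) (t : T) :=
  GRing.isLinear.Build k C (tens {malg E[T]}) _ (tgen t) (tgen_linear t).

Lemma tcoef_tgen (T : choiceType) (s t : T) c :
  tcoef s (tgen t c) = if t == s then c else 0.
Proof.
rewrite tcoefE mcoeffU; case: eqP => _; first by rewrite scale1r iotaK.
by rewrite mulr0n scale0r; apply: (@addIr _ (kappa 0)); rewrite -kappaD !add0r.
Qed.

Lemma pure_tgen (T : choiceType) (t : T) c (e : E) :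
  pure _ _ _ (iota c) (e *: << t >>) = tgen t (kappa ((e : E^c) *: iota c)).
Proof. by rewrite -pureA /tgen kappaK. Qed.

Lemma tensE (T : finType) (z : tens {malg E[T]}) :
  z = \sum_t tgen t (tcoef t z).
Proof.
move: z; apply: tensor_ind.
  split; first by rewrite big1 // => t _; rewrite !linear0.
  move=> c u v {1}-> {1}->; rewrite scaler_sumr -big_split.
  by apply: eq_bigr => t _; rewrite !linearP.
move=> m p; move: p m; apply: malg_ind; first split.
- by move=> m; rewrite pure0r big1 // => t _; rewrite !linear0.
- move=> e p p' Hp Hp' m; rewrite pureDr {1}Hp' -pureA {1}Hp -big_split.
  by apply: eq_bigr => t _; rewrite !linearD.
move=> t m.
have -> : pure _ _ _ m << t >> = tgen t (kappa m) :> tens {malg E[T]}.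
  by rewrite /tgen kappaK.
rewrite (bigD1 t) //= big1 => [|s st]; first by rewrite tcoef_tgen eqxx addr0.
by rewrite tcoef_tgen eq_sym (negPf st) linear0.
Qed.

Lemma kappaB m m' : kappa (m - m') = kappa m - kappa m'.
Proof. by apply/eqP; rewrite eq_sym subr_eq -kappaD subrK. Qed.

Lemma kappa_dX c m : kappa ((dX c : E^c) *: m) = rX c (kappa m).
Proof.
rewrite /dX -epZl [X in kappa X](scalerBl (ep (c *: x) 1 : E^c) (ep 1 x)).
by rewrite kappaB !kappa_ep mul1r mulr1 -scalerAr.
Qed.

Lemma kappa_dY c m : kappa ((dY c : E^c) *: m) = rY c (kappa m).
Proof.
rewrite /dY -epZr [X in kappa X](scalerBl (ep y 1 : E^c) (ep 1 (c *: y))).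
by rewrite kappaB !kappa_ep mul1r mulr1 -scalerAl.
Qed.

Lemma tdiff1E a b :
  tens_diff M koszul_diff 1 (tgen true a + tgen false b) =
    tgen tt (rX 1 a + rY 1 b).
Proof.
rewrite linearD /= !tens_map_pure /= !fliftU /= !pure_tgen -linearD.
by rewrite kappa_dX kappa_dY !iotaK.
Qed.

Lemma tdiff2E c :
  tens_diff M koszul_diff 2 (tgen tt c) =
    tgen true (rY q c) - tgen false (rX q c).
Proof.
rewrite /= tens_map_pure /= fliftU /= pureBr 2!pure_tgen.
by rewrite kappa_dX kappa_dY !iotaK.
Qed.

Hypothesis hq : forall m : nat, (0 < m)%N -> q ^+ m != 1.

Variables (N : lmodType E) (n0 : N).
Hypothesis ep_n0 : forall a b, ep a b *: n0 = ep (a * b) 1 *: n0.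
Hypothesis n0_gen : forall n, exists c, n = ep c 1 *: n0.
Hypothesis n0_free : forall c, ep c 1 *: n0 = 0 -> c = 0.

Lemma tens_unitE (z : tens {malg E[unit]}) : z = tgen tt (tcoef tt z).
Proof. by rewrite [LHS]tensE (big_pred1 tt) // => -[]. Qed.

Lemma tens_boolE (z : tens {malg E[bool]}) :
  z = tgen true (tcoef true z) + tgen false (tcoef false z).
Proof. by rewrite [LHS]tensE big_bool. Qed.

(** The isomorphisms read off the part of degree 0 in [x], of the single coordinate
    in degree 0 and of the coordinate along [e_y] in degree 1. *)
Lemma Tor_koszul n :
  ((n <= 1)%N -> lin_iso (Tor M N n) (laurent k)) /\
  ((2 <= n)%N -> forall z : Tor M N n, z = 0).
Proof.
have res := koszul_resolution ep_n0 n0_gen n0_free.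
case: n => [|[|n]]; split=> // _.
- apply: (@Tor_iso _ _ _ _ _ _ _ 0 _ (rho \o tcoef tt) res) => [z _|w] /=.
    split=> [z0|[u ->]].
      exists (tgen true 0 + tgen false (rYinv 1 (tcoef tt z))).
      rewrite tdiff1E linear0 add0r rYinvC (rYK1 hq) z0 linear0 subr0.
      exact: tens_unitE.
    by rewrite (tens_boolE u) tdiff1E tcoef_tgen linearD /= rho_rX rho_rY addr0.
  by exists (tgen tt (sec w)) => //; rewrite tcoef_tgen rho_sec.
- apply: (@Tor_iso _ _ _ _ _ _ _ 1 _ (rho \o tcoef false) res) => [z|w] /=;
    last first.
    exists (tgen false (sec w)); last by rewrite tcoef_tgen rho_sec.
    rewrite /cycle -[tgen _ _]add0r -(linear0 (tgen true)) tdiff1E.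
    by rewrite linear0 rY_sec addr0 linear0.
  rewrite {1}(tens_boolE z) /cycle tdiff1E => /(congr1 (tcoef tt)).
  rewrite tcoef_tgen linear0 /= => zc; split=> [z0|[u ->]].
    (* The boundary of [c e_xy] has the same component along [e_x] as [z]. *)
    pose c := rYinv q (tcoef true z); exists (tgen tt c).
    have Ea : rY q c = tcoef true z by rewrite rYinvC (rYK hq).
    suff Eb : tcoef false z = - rX q c.
      by rewrite tdiff2E Ea -linearN -Eb -tens_boolE.
    apply/eqP; rewrite -addr_eq0; set b := _ + _.
    have Yb : rY 1 b = 0 by rewrite linearD /= -rX_rY Ea addrC.
    have rhob : rho b = 0 by rewrite linearD /= z0 rho_rX addr0.
    have := rYK1 hq b.
    by rewrite Yb rhob (linear0 (rYinv 1)) (linear0 sec) subr0 => <-.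
  rewrite (tens_unitE u) tdiff2E linearB /= !tcoef_tgen /= sub0r linearN /=.
  by rewrite rho_rX oppr0.
case: n => [|n].
- apply: (Tor_eq0 res) => z.
  rewrite {1}(tens_unitE z) /cycle tdiff2E => /(congr1 (tcoef true)).
  rewrite linearB /= !tcoef_tgen /= subr0 linear0 => /(congr1 (rYinv q)).
  rewrite (rYK hq) linear0 => z0.
  by exists 0; rewrite linear0 (tens_unitE z) z0 linear0.
apply: (Tor_eq0 res) => z _; exists 0.
by rewrite linear0 (@tensE void z) big1 // => -[].
Qed.

End Coefficients.
End Enveloping.
End QuantumCylinder.

(** * Hochschild homology of the quantum cylinder *)

Section EnvelopingFacts.
Variables (k : comNzRingType) (C : algType k).

Lemma env_universal (f : C -> C -> env C) :
  (forall b, linear (f^~ b)) -> (forall a, linear (f a)) ->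
  exists F : {linear env C -> env C}, forall a b, F (epure a b) = f a b.
Proof.
move=> fl fr; have bal := env_balanced (f := f) fl fr.
exists (HB.pack_for {linear env C -> env C} (tlift f : env C -> env C)
  (GRing.isLinear.Build k (env C) (env C) _ (tlift f : env C -> env C)
    (tlift_linear bal))).
exact: (tlift_pure bal).
Qed.

Lemma left_regE (a b : C) (c : left_reg C) :
  (epure a b : env C) *: c = a * c * b :> C.
Proof. exact: env_lact_pure. Qed.

Lemma right_regE (a b : C) (c : right_reg C) :
  (epure a b : (env C)^c) *: c = b * c * a :> C.
Proof. exact: env_ract_pure. Qed.

End EnvelopingFacts.

Theorem mainTheorem5 (k : fieldType) (hchar : [pchar k] =i pred0)
    (q : k) (q0 : q != 0) (hq : forall m : nat, (0 < m)%N -> q ^+ m != 1)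
    (n : nat) :
  ((n <= 1)%N -> lin_iso (HH (qcyl q0) n) (laurent k)) /\
  ((2 <= n)%N -> forall z : HH (qcyl q0) n, z = 0).
Proof.
pose C := qcyl q0.
apply: (@Tor_koszul k q q0 (env C) (@epure k C) _ _ _ _ _
  (right_reg C) id id _ _ _ _ _ hq (left_reg C) (1 : C)).
- exact: epure_linl.
- exact: epure_linr.
- by move=> a b a' b'; exact: env_mul_pure.
- exact: env_ind.
- exact: env_universal.
- by [].
- by [].
- by [].
- exact: right_regE.
- by [].
- move=> a b; apply: (etrans (left_regE a b 1)).
  by apply/esym/(etrans (left_regE _ _ _)); rewrite !mulr1.
- by move=> c; exists c; apply/esym/(etrans (left_regE _ _ _)); rewrite !mulr1.
- by move=> c /(etrans (esym (left_regE _ _ _))); rewrite !mulr1.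
Qed.
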